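(* Let $n\ge 3$, $K=\mathbb R^n_+$, let $A=(a_{ij})\in\mathbb R^{n\times n}$ be a symmetric matrix, $b=(b_1,\dots,b_n)^\top\in\mathbb R^n$, $c\in\mathbb R$, and let $f:\mathbb S^n\cap\operatorname{int}(K)\to\mathbb R$ be defined by $f(x)=\langle Ax,x\rangle+\langle b,x\rangle+c$. Suppose that $A$ is a $Z$-matrix and $$b_i\le 2\left[\lambda_{\min}(A)-a_{ii}\right]$$ for all $i\in[n]$. Then $f$ is spherically convex.
   Context: $\langle x,y\rangle=x^\top y$ is the canonical inner product on $\mathbb R^n$, $\|\cdot\|$ the Euclidean norm, $\mathbb S^n=\{x\in\mathbb R^n:\|x\|=1\}$, $[n]=\{1,\dots,n\}$, $\mathbb R^n_+$ is the nonnegative orthant, and $\lambda_{\min}(A)$ the smallest eigenvalue of $A$. A $Z$-matrix is a square matrix whose off-diagonal entries are all nonpositive. Geodesics of $\mathbb S^n$ are great circles (intersections of $\mathbb S^n$ with two-dimensional subspaces); a minimal geodesic segment is a shortest great-circle arc joining two points, parametrized proportionally to arc length. A function $f:\mathbb S^n\cap\operatorname{int}(K)\to\mathbb R$ is spherically convex if for every minimal geodesic segment $\gamma:J\to\mathbb S^n\cap\operatorname{int}(K)$ ($J$ an interval), the composition $f\circ\gamma$ is convex on $J$. *)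

(* Defs.v *)
(* MathComp / MathComp-Analysis *)
From mathcomp Require Import all_boot all_order all_algebra.
From mathcomp Require Import all_classical all_reals all_analysis.

Set Implicit Arguments.
Unset Strict Implicit.
Unset Printing Implicit Defensive.

Import Order.TTheory GRing.Theory Num.Theory.
Import numFieldNormedType.Exports.
Local Open Scope classical_set_scope.
Local Open Scope ring_scope.

Definition inner (R : realType) (n : nat) (x y : 'cV[R]_n) : R :=
  (x^T *m y) 0 0.

(* Not the library norm `|x|, which on matrices is the sup norm. *)
Definition enorm (R : realType) (n : nat) (x : 'cV[R]_n) : R :=
  Num.sqrt (inner x x).

Definition sphere (R : realType) (n : nat) : set 'cV[R]_n :=
  [set x | enorm x = 1].

Definition nonneg_orthant (R : realType) (n : nat) : set 'cV[R]_n :=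
  [set x | forall i, 0 <= x i 0].

Definition Z_matrix (R : realType) (n : nat) (A : 'M[R]_n) : Prop :=
  forall i j, i != j -> A i j <= 0.

(* The least element of the real spectrum (0 if there is none, which does not
   happen for a symmetric matrix of positive size). *)
Definition lambda_min (R : realType) (n : nat) (A : 'M[R]_n) : R :=
  xget 0 [set l | eigenvalue A l /\ forall m, eigenvalue A m -> l <= m].

Definition great_circle (R : realType) (n : nat) (C : set 'cV[R]_n) : Prop :=
  exists W : {vspace 'cV[R]_n},
    \dim W = 2%N /\ C = @sphere R n `&` [set x | x \in W].

(* Length of a shortest great-circle arc joining two points of the sphere. *)
Definition sphere_dist (R : realType) (n : nat) (x y : 'cV[R]_n) : R :=
  acos (inner x y).

(* For p, v orthogonal in a great circle C, t |-> cos t *: p + sin t *: v runs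
   through C at unit speed, so that g has constant speed `|w| and its arc from
   g s to g t has length `|w| * `|t - s|.  Constant curves (w = 0) are
   included. *)
Definition minimal_geodesic (R : realType) (n : nat)
    (J : set R) (g : R -> 'cV[R]_n) : Prop :=
  exists (C : set 'cV[R]_n) (p v : 'cV[R]_n) (w : R),
    [/\ great_circle C, C p /\ C v, inner p v = 0,
        forall t, J t -> g t = cos (w * t) *: p + sin (w * t) *: v &
        forall s t, J s -> J t ->
          `|w| * `|t - s| = sphere_dist (g s) (g t)].

(* Only the values of f on the intersection of the sphere with K° matter. *)
Definition spherically_convex (R : realType) (n : nat)
    (K : set 'cV[R]_n) (f : 'cV[R]_n -> R) : Prop :=
  forall (J : set R) (g : R -> 'cV[R]_n),
    is_interval J ->
    minimal_geodesic J g ->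
    (forall t, J t -> (@sphere R n `&` K°) (g t)) ->
    @convex_function R R^o J (f \o g).

(* Main.v *)
Require Import Defs.
From mathcomp Require Import all_boot all_order all_algebra.
From mathcomp Require Import all_classical all_reals all_analysis.
From mathcomp Require Import ring lra.

Set Implicit Arguments.
Unset Strict Implicit.
Unset Printing Implicit Defensive.

Import Order.TTheory GRing.Theory Num.Theory.
Import numFieldNormedType.Exports.
Local Open Scope classical_set_scope.
Local Open Scope ring_scope.

(** Along a great circle parametrized by x = cos (w t) p + sin (w t) v, with
    unit velocity direction y = - sin (w t) p + cos (w t) v, the second
    derivative of f is w ^ 2 times
      2 (<A y, y> - <A x, x>) - <b, x>,
    so convexity follows once this is nonnegative whenever x and y are unit
    vectors and x lies in the nonnegative orthant
    ([spherical_hessian_ge0]).  Write l for the least eigenvalue of A.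

    Three bounds combine.  First, <A y, y> >= l, by the Rayleigh principle
    ([lambda_min_rayleigh]).  Second, since x >= 0 and the off-diagonal entries
    of A are nonpositive, <A x, x> is at most the sum of a_ii x_i ^ 2
    ([Z_matrix_form_le_diag]).  Third, the hypothesis on b gives
    - <b, x> >= sum of 2 (a_ii - l) x_i.  As the x_i ^ 2 add up to 1, the
    expression is at least
      sum of 2 (a_ii - l) (x_i - x_i ^ 2),
    which is nonnegative because a_ii >= l and 0 <= x_i <= 1.

    The Rayleigh principle is obtained from compactness of the unit sphere:
    the quadratic form of A attains there a minimum m, at some u
    ([exists_rayleigh_min]).  Then A - m I is positive semidefinite with u in
    its null cone, so it kills u ([psd_kernel]): m is an eigenvalue, and it
    bounds from below every other one.  In particular a least eigenvalue
    exists, which is what gives the chosen value lambda_min its meaning. *)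

(** * Inner product *)

Lemma innerE (R : realType) (n : nat) (x y : 'cV[R]_n) :
  inner x y = \sum_i x i 0 * y i 0.
Proof. by rewrite /inner mxE; apply: eq_bigr => i _; rewrite mxE. Qed.

Lemma innerC (R : realType) (n : nat) (x y : 'cV[R]_n) :
  inner x y = inner y x.
Proof. by rewrite !innerE; apply: eq_bigr => i _; rewrite mulrC. Qed.

Lemma innerDl (R : realType) (n : nat) (x y z : 'cV[R]_n) :
  inner (x + y) z = inner x z + inner y z.
Proof. by rewrite /inner linearD mulmxDl mxE. Qed.

Lemma innerZl (R : realType) (n : nat) (a : R) (x y : 'cV[R]_n) :
  inner (a *: x) y = a * inner x y.
Proof. by rewrite /inner linearZ /= -scalemxAl mxE. Qed.

Lemma innerDr (R : realType) (n : nat) (x y z : 'cV[R]_n) :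
  inner z (x + y) = inner z x + inner z y.
Proof. by rewrite innerC innerDl !(innerC z). Qed.

Lemma innerZr (R : realType) (n : nat) (a : R) (x y : 'cV[R]_n) :
  inner y (a *: x) = a * inner y x.
Proof. by rewrite innerC innerZl innerC. Qed.

Lemma inner_ge0 (R : realType) (n : nat) (x : 'cV[R]_n) :
  0 <= inner x x.
Proof. by rewrite innerE sumr_ge0// => i _; rewrite -expr2 sqr_ge0. Qed.

Lemma inner_eq0 (R : realType) (n : nat) (x : 'cV[R]_n) :
  inner x x = 0 -> x = 0.
Proof.
rewrite innerE => /eqP; rewrite psumr_eq0 => [/allP x0|i _]; last first.
  by rewrite -expr2 sqr_ge0.
apply/matrixP => i j; rewrite ord1 mxE.
by have := x0 i (mem_index_enum i); rewrite /= mulf_eq0 orbb => /eqP.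
Qed.

Lemma sphere_inner (R : realType) (n : nat) (x : 'cV[R]_n) :
  sphere x -> inner x x = 1.
Proof.
rewrite /sphere/= /enorm => x1.
by rewrite -[LHS]sqr_sqrtr ?inner_ge0// x1 expr1n.
Qed.

Lemma inner_mulmx_sym (R : realType) (n : nat)
    (A : 'M[R]_n) (x y : 'cV[R]_n) :
  A^T = A -> inner (A *m x) y = inner (A *m y) x.
Proof.
by move=> symA; rewrite [RHS]innerC /inner trmx_mul symA mulmxA.
Qed.

(** * Convexity from the second derivative *)

Lemma interval_conv (R : realType) (J : set R) (t : {i01 R}) (x y : R^o) :
  is_interval J -> J x -> J y -> J (conv t x y).
Proof.
wlog xy : x y t / x <= y => [wlogxy|] intJ Jx Jy.
  have [xy|/ltW yx] := leP x y; first exact: wlogxy.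
  by rewrite convC; exact: wlogxy.
by have := convR_itv t xy; rewrite in_itv/= => /(intJ _ _ Jx Jy).
Qed.

(** The derivatives are required to exist on the whole line, although the sign
    condition bears on J only: trigonometric polynomials satisfy this, and it
    spares one-sided continuity conditions at the endpoints. *)
Lemma second_derivative_ge0_convex (R : realType) (J : set R)
    (f f1 f2 : R -> R) :
  is_interval J ->
  (forall t, is_derive t (1 : R) f (f1 t)) ->
  (forall t, is_derive t (1 : R) f1 (f2 t)) ->
  (forall t, J t -> 0 <= f2 t) ->
  @convex_function R R^o J f.
Proof.
move=> intJ df df1 f2_ge0.
have Df : 'D_1 (f : R -> R^o) = f1 by apply/funext => t; apply: derive_val.
have contf t : {for t, continuous f}.
  by apply/differentiable_continuous/derivable1_diffP; apply: ex_derive.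
have ordered (t : {i01 R}) (x y : R^o) : J x -> J y -> x <= y ->
    f (conv t x y) <= conv t (f x : R^o) (f y).
  move=> Jx Jy xy; apply: (@second_derivative_convex R f) => //.
  - move=> z /andP[xz zy]; rewrite Df derive_val f2_ge0//.
    by apply: (intJ x y) => //; rewrite !ltW.
  - exact/cvg_at_left_filter/contf.
  - exact/cvg_at_right_filter/contf.
  - by move=> z _; rewrite Df; apply: ex_derive.
move=> t x y /set_mem Jx /set_mem Jy.
have [xy|/ltW yx] := leP x y; first exact: ordered.
by rewrite convC [leRHS]convC; exact: ordered.
Qed.

(** * The Rayleigh principle *)

Lemma sum_continuous (R : realType) (T : topologicalType) (m : nat)
    (F : 'I_m -> T -> R) :
  (forall i, continuous (F i)) -> continuous (fun x => \sum_i F i x).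
Proof.
have addc : continuous (fun x : R * R => +%R x.1 x.2) := @add_continuous R^o.
move=> cF.
exact: (@continuous_big R 'I_m +%R 0 xpredT addc T _ F (fun i _ => cF i)).
Qed.

(** Row vectors appear here because the compactness and extreme value theorems
    on R ^ n are stated for them. *)
Lemma quadratic_form_continuous (R : realType) (n : nat) (A : 'M[R]_n) :
  continuous (fun u : 'rV[R]_n => inner (A *m u^T) u^T).
Proof.
rewrite (_ : (fun _ => _) =
    fun v : 'rV[R]_n => \sum_i (\sum_j A i j * v 0 j) * v 0 i); last first.
  apply/funext => v; rewrite innerE; apply: eq_bigr => i _; rewrite !mxE.
  by congr (_ * _); apply: eq_bigr => j _; rewrite mxE.
have coord j : continuous (fun v : 'rV[R]_n => v 0 j).
  exact: coord_continuous.
have row_cont i : continuous (fun v : 'rV[R]_n => \sum_j A i j * v 0 j).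
  apply: (@sum_continuous R 'rV[R]_n n (fun j v => A i j * v 0 j)) => j u.
  apply: continuousM; last exact: coord.
  exact: cst_continuous.
apply: (@sum_continuous R 'rV[R]_n n
  (fun i v => (\sum_j A i j * v 0 j) * v 0 i)) => i u.
exact: (continuousM (row_cont i u) (coord i u)).
Qed.

(** The sphere is a closed subset of the cube [-1, 1] ^ n. *)
Lemma unit_rV_compact (R : realType) (n : nat) :
  compact [set u : 'rV[R]_n | inner u^T u^T = 1].
Proof.
pose cube := [set u : 'rV[R]_n | forall i, `[-1, 1]%classic (u ord0 i)].
apply: (@subclosed_compact _ _ cube).
- have /continuous_closedP := @quadratic_form_continuous R n 1%:M.
  move=> /(_ [set 1] (@closed_eq _ _)).
  by congr closed; apply/funext => u; rewrite /= mul1mx.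
- apply: (@rV_compact R n (fun=> `[-1, 1]%classic)) => i.
  exact: segment_compact.
- move=> u /= u1 i; rewrite /= in_itv/= -ler_norml -(@ler_pXn2r _ 2)// ?nnegrE//.
  rewrite real_normK ?num_real// expr1n -u1 innerE (bigD1 i)//= !mxE expr2 lerDl.
  by apply: sumr_ge0 => j _; rewrite !mxE -expr2 sqr_ge0.
Qed.

(** With y = B x, nonnegativity of the form at x + t y reads
    0 <= 2 t <y, y> + t ^ 2 <B y, y> for all t; a small negative t would
    violate it unless y = 0. *)
Lemma psd_kernel (R : realType) (n : nat) (B : 'M[R]_n) (x : 'cV[R]_n) :
  B^T = B -> (forall y, 0 <= inner (B *m y) y) -> inner (B *m x) x = 0 ->
  B *m x = 0.
Proof.
move=> symB psdB Bxx; apply: inner_eq0; set y := B *m x.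
set a := inner y y; set d := inner (B *m y) y.
have q t : 0 <= 2 * t * a + t ^+ 2 * d.
  have := psdB (x + t *: y).
  rewrite mulmxDr -scalemxAr !(innerDl, innerDr, innerZl, innerZr) Bxx.
  rewrite (inner_mulmx_sym y x symB) -/y -/a -/d; lra.
have a_ge0 : 0 <= a := inner_ge0 y.
have d_ge0 : 0 <= d := psdB y.
have d1_gt0 : 0 < d + 1 by lra.
(* t = - a / (d + 1): the minimizer - a / d, shifted to allow d = 0 *)
have : 0 <= - (a ^+ 2 * (d + 2)) / (d + 1) ^+ 2.
  rewrite (_ : _ / _ = 2 * - (a / (d + 1)) * a + (- (a / (d + 1))) ^+ 2 * d) ?q//.
  by field; rewrite gt_eqF.
rewrite pmulr_lge0 ?invr_gt0 ?exprn_gt0// oppr_ge0 pmulr_lle0; last lra.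
by move=> ?; apply/eqP; rewrite -sqrf_eq0 eq_le sqr_ge0 andbT.
Qed.

(** The minimum over the compact unit sphere, made homogeneous of degree 2 so
    that it can be used on arbitrary vectors. *)
Lemma exists_rayleigh_min (R : realType) (n : nat) (A : 'M[R]_n) :
  (0 < n)%N ->
  exists2 x : 'cV[R]_n, inner x x = 1 &
    forall y, inner (A *m x) x * inner y y <= inner (A *m y) y.
Proof.
move=> n_gt0; pose e : 'cV[R]_n := \col_i (i == Ordinal n_gt0)%:R.
have S0 : [set u : 'rV[R]_n | inner u^T u^T = 1] !=set0.
  exists e^T => /=; rewrite trmxK innerE (bigD1 (Ordinal n_gt0))//=.
  rewrite big1 ?addr0; first by rewrite !mxE eqxx mulr1.
  by move=> i /negPf i0; rewrite !mxE i0 mulr0.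
have [u /set_mem/= u1 umin] := EVT_min_rV S0 (@unit_rV_compact R n)
  (continuous_subspaceT (@quadratic_form_continuous R n A)).
exists u^T => // y; have [->|y0] := eqVneq y 0.
  by rewrite mulmx0 -(scale0r (0 : 'cV_n)) !innerZl !mul0r mulr0.
have yy : 0 < inner y y.
  by rewrite lt_def inner_ge0 andbT; apply: contraNneq y0 => /inner_eq0/eqP.
have yy2 := sqr_sqrtr (ltW yy).
have s0 : Num.sqrt (inner y y) != 0 by rewrite sqrtr_eq0 -ltNge.
have := umin ((Num.sqrt (inner y y))^-1 *: y)^T.
rewrite inE/= trmxK -scalemxAr !(innerZl, innerZr) !mulrA -!expr2 exprVn yy2.
rewrite mulVf ?gt_eqF// => /(_ erefl).
by rewrite ler_pdivlMl// [leLHS]mulrC.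
Qed.

(** The minimum m of the form on the unit sphere is the least eigenvalue:
    minimality puts the minimizer in the kernel of A - m I by [psd_kernel], and
    testing the form on an eigenvector bounds its eigenvalue by m from below. *)
Lemma lambda_min_rayleigh (R : realType) (n : nat) (A : 'M[R]_n)
    (x : 'cV[R]_n) :
  (0 < n)%N -> A^T = A -> lambda_min A * inner x x <= inner (A *m x) x.
Proof.
move=> n_gt0 symA; have [u u1 umin] := exists_rayleigh_min A n_gt0.
set m := inner (A *m u) u in umin.
(* eigenvalue concerns row vectors; symmetry of A transposes it to columns *)
have eigenP l : eigenvalue A l <->
    exists2 v : 'cV[R]_n, A *m v = l *: v & v != 0.
  split=> [/eigenvalueP[v vA v0]|[v Av v0]].
    exists v^T; first by rewrite -[in LHS]symA -trmx_mul vA linearZ.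
    by apply: contraNneq v0 => /(congr1 trmx); rewrite trmxK trmx0 => ->.
  apply/eigenvalueP; exists v^T.
    by rewrite -[in LHS]symA -trmx_mul Av linearZ.
  by apply: contraNneq v0 => /(congr1 trmx); rewrite trmxK trmx0 => ->.
have u0 : u != 0.
  apply: contra_eq_neq u1 => ->.
  by rewrite -(scale0r (0 : 'cV_n)) innerZl mul0r eq_sym oner_eq0.
have eig_m : eigenvalue A m.
  apply/eigenP; exists u => //; apply/eqP; rewrite -subr_eq0 -mul_scalar_mx.
  have shift y : inner ((A - m%:M) *m y) y = inner (A *m y) y - m * inner y y.
    by rewrite mulmxBl mul_scalar_mx -scaleNr innerDl innerZl mulNr.
  rewrite -mulmxBl; apply/eqP/psd_kernel.
  - by rewrite linearB/= symA tr_scalar_mx.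
  - by move=> y; rewrite shift subr_ge0.
  - by rewrite shift u1 mulr1 subrr.
pose least := [set l | eigenvalue A l /\ forall l', eigenvalue A l' -> l <= l'].
have least_m : least m.
  split=> // l /eigenP[v Av v0]; have := umin v; rewrite Av innerZl.
  rewrite ler_pM2r// lt_def inner_ge0 andbT.
  by apply: contraNneq v0 => /inner_eq0/eqP.
have [_ /(_ m eig_m) lambda_le] := xgetPex 0 (ex_intro least m least_m).
exact: le_trans (ler_wpM2r (inner_ge0 x) lambda_le) (umin x).
Qed.

Lemma lambda_min_le_diag (R : realType) (n : nat) (A : 'M[R]_n) (i : 'I_n) :
  A^T = A -> lambda_min A <= A i i.
Proof.
move=> symA; have n_gt0 : (0 < n)%N by apply: leq_ltn_trans (ltn_ord i).
have := lambda_min_rayleigh (delta_mx i 0) n_gt0 symA.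
rewrite -colE !innerE (bigD1 i)//= big1 => [|j /negPf ji]; last first.
  by rewrite !mxE ji mul0r.
rewrite [in leRHS](bigD1 i)//= big1 => [|j /negPf ji]; last first.
  by rewrite !mxE ji mulr0.
by rewrite !mxE !eqxx !addr0 !mulr1.
Qed.

(** * The second derivative along great circles *)

Lemma Z_matrix_form_le_diag (R : realType) (n : nat) (A : 'M[R]_n)
    (x : 'cV[R]_n) :
  Z_matrix A -> (forall i, 0 <= x i 0) ->
  inner (A *m x) x <= \sum_i A i i * x i 0 ^+ 2.
Proof.
move=> ZA x_ge0; rewrite innerE; apply: ler_sum => i _.
rewrite mxE expr2 mulrA ler_wpM2r//.
rewrite (bigD1 i)//= gerDl; apply: sumr_le0 => j ji.
by rewrite mulr_le0_ge0// ?ZA// 1?eq_sym//; exact: x_ge0.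
Qed.

(** The left-hand side is at least the sum of
    2 (a_ii - l) x_i (1 - x_i), where l is the least eigenvalue; normalization
    of x turns l into the sum of the l x_i ^ 2, which makes the three bounds
    comparable coordinate by coordinate. *)
Lemma spherical_hessian_ge0 (R : realType) (n : nat) (A : 'M[R]_n)
    (b x y : 'cV[R]_n) :
  (0 < n)%N -> A^T = A -> Z_matrix A ->
  (forall i, b i 0 <= 2 * (lambda_min A - A i i)) ->
  (forall i, 0 <= x i 0) -> inner x x = 1 -> inner y y = 1 ->
  0 <= 2 * (inner (A *m y) y - inner (A *m x) x) - inner b x.
Proof.
move=> n_gt0 symA ZA hb x_ge0 x1 y1; set l := lambda_min A in hb.
have Ay : l <= inner (A *m y) y.
  by have := lambda_min_rayleigh y n_gt0 symA; rewrite y1 mulr1.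
have Ax := Z_matrix_form_le_diag ZA x_ge0.
have bx : inner b x <= \sum_i 2 * (l - A i i) * x i 0.
  by rewrite innerE; apply: ler_sum => i _; rewrite ler_wpM2r ?hb//; exact: x_ge0.
have x_le1 i : x i 0 <= 1.
  rewrite -(@ler_pXn2r _ 2)// ?nnegrE// ?x_ge0// expr1n -x1 innerE (bigD1 i)//=.
  by rewrite expr2 lerDl sumr_ge0// => j _; rewrite -expr2 sqr_ge0.
have : 0 <= \sum_i 2 * (A i i - l) * (x i 0 * (1 - x i 0)).
  apply: sumr_ge0 => i _; rewrite !mulr_ge0 ?subr_ge0//.
  exact: lambda_min_le_diag.
suff -> : \sum_i 2 * (A i i - l) * (x i 0 * (1 - x i 0)) =
    2 * (l - \sum_i A i i * x i 0 ^+ 2) - \sum_i 2 * (l - A i i) * x i 0.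
  by lra.
(* spread l over the coordinates using <x, x> = 1 *)
rewrite -[l in 2 * (l - _)]mulr1 -[X in l * X]x1 innerE mulr_sumr -!sumrB.
by rewrite mulr_sumr -sumrB; apply: eq_bigr => i _; ring.
Qed.

Lemma quadratic_form_comb (R : realType) (n : nat) (A : 'M[R]_n)
    (p v : 'cV[R]_n) (C S : R) :
  A^T = A ->
  inner (A *m (C *: p + S *: v)) (C *: p + S *: v) =
  inner (A *m p) p * C ^+ 2 + 2 * inner (A *m p) v * (C * S)
  + inner (A *m v) v * S ^+ 2.
Proof.
move=> symA; rewrite mulmxDr -!scalemxAr !(innerDl, innerDr, innerZl, innerZr).
by rewrite (inner_mulmx_sym v p symA); ring.
Qed.

(** For a function f(x) = <A x, x> + <b, x> + c, the coefficients are
    P = <A p, p>, Q = <A p, v>, S = <A v, v>, bp = <b, p>, bv = <b, v>. *)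
Lemma trig_quadratic_derivatives (R : realType) (w P Q S bp bv c : R) :
  let f t := P * cos (w * t) ^+ 2 + 2 * Q * (cos (w * t) * sin (w * t))
    + S * sin (w * t) ^+ 2 + bp * cos (w * t) + bv * sin (w * t) + c in
  let f1 t := w * (2 * (S - P) * (cos (w * t) * sin (w * t))
    + 2 * Q * (cos (w * t) ^+ 2 - sin (w * t) ^+ 2)
    - bp * sin (w * t) + bv * cos (w * t)) in
  let f2 t := w ^+ 2 * (2 * (S - P) * (cos (w * t) ^+ 2 - sin (w * t) ^+ 2)
    - 8 * Q * (cos (w * t) * sin (w * t))
    - bp * cos (w * t) - bv * sin (w * t)) in
  forall t, is_derive t (1 : R) f (f1 t) /\ is_derive t (1 : R) f1 (f2 t).
Proof.
move=> f f1 f2 t.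
have dwt : is_derive t (1 : R) (fun t => w * t) w.
  by apply: is_derive_eq; rewrite /GRing.scale/=; ring.
have dcos : is_derive t (1 : R) (fun t => cos (w * t)) (- sin (w * t) * w).
  exact: (is_derive1_comp (f := cos)).
have dsin : is_derive t (1 : R) (fun t => sin (w * t)) (cos (w * t) * w).
  exact: (is_derive1_comp (f := sin)).
split; rewrite /f /f1 /f2; apply: is_derive_eq; rewrite /GRing.scale/=; ring.
Qed.

Theorem corollary2 (R : realType) (n : nat) (hn : (3 <= n)%N)
    (A : 'M[R]_n) (b : 'cV[R]_n) (c : R)
    (hAsym : A^T = A)
    (hAZ : Z_matrix A)
    (hb : forall i : 'I_n, b i 0 <= 2 * (lambda_min A - A i i)) :
  spherically_convex (@nonneg_orthant R n)
    (fun x => inner (A *m x) x + inner b x + c).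
Proof.
move=> J g intJ [C [p [v [w [[W [_ ->]] [[p1 _] [v1 _]] pv gE _]]]]] gK.
have {}p1 := sphere_inner p1; have {}v1 := sphere_inner v1.
have deriv := @trig_quadratic_derivatives R w (inner (A *m p) p)
  (inner (A *m p) v) (inner (A *m v) v) (inner b p) (inner b v) c.
have cvx := second_derivative_ge0_convex intJ
  (fun t => (deriv t).1) (fun t => (deriv t).2).
have f2_ge0 t : J t -> 0 <= w ^+ 2 * (2 * (inner (A *m v) v - inner (A *m p) p)
      * (cos (w * t) ^+ 2 - sin (w * t) ^+ 2)
    - 8 * inner (A *m p) v * (cos (w * t) * sin (w * t))
    - inner b p * cos (w * t) - inner b v * sin (w * t)).
  move=> Jt; rewrite mulr_ge0 ?sqr_ge0//.
  have [/sphere_inner + /interior_subset] := gK _ Jt; rewrite gE//.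
  have := cos2Dsin2 (w * t); set co := cos (w * t); set si := sin (w * t).
  move=> cs u1 u_ge0.
  (* the unit tangent vector of the circle at its point co *: p + si *: v *)
  have u'1 : inner (- si *: p + co *: v) (- si *: p + co *: v) = 1.
    rewrite !(innerDl, innerDr, innerZl, innerZr) (innerC v p) pv p1 v1.
    by rewrite -[RHS]cs; ring.
  have n_gt0 : (0 < n)%N := ltn_trans (isT : 0 < 2)%N hn.
  have := spherical_hessian_ge0 n_gt0 hAsym hAZ hb u_ge0 u1 u'1.
  rewrite !quadratic_form_comb// innerDr !innerZr.
  move=> hess_ge0; apply: (le_trans hess_ge0).
  by rewrite le_eqVlt; apply/orP; left; apply/eqP; ring.
have fgE t : J t -> inner (A *m g t) (g t) + inner b (g t) + c =
    inner (A *m p) p * cos (w * t) ^+ 2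
    + 2 * inner (A *m p) v * (cos (w * t) * sin (w * t))
    + inner (A *m v) v * sin (w * t) ^+ 2
    + inner b p * cos (w * t) + inner b v * sin (w * t) + c.
  by move=> Jt; rewrite gE// quadratic_form_comb// innerDr !innerZr; ring.
move=> t x y Jx Jy; have Jxy := interval_conv t intJ (set_mem Jx) (set_mem Jy).
rewrite /= (fgE _ Jxy) (fgE _ (set_mem Jx)) (fgE _ (set_mem Jy)).
exact: (cvx f2_ge0 t x y Jx Jy).
Qed.
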